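(* Let $T_\infty$ be the infinite rooted binary tree with root $x_0$, fix a labeling of $T_\infty$, and fix an integer $\ell\geq 2$. Then $\widetilde{M}_{\ell}$ and $M_{\ell}$ are subgroups of $\operatorname{Aut}(T_\infty)$.
   Context: A labeling of $T_\infty$ assigns to each node at level $m$ a word in $\{0,1\}^m$ (the root gets the empty word), bijectively on each level, so that the two children of the node labeled $w$ are labeled $w0$ and $w1$. For $\sigma\in\operatorname{Aut}(T_\infty)$ (automorphisms of the rooted tree), a node $y$ and $m\geq 1$: $\sigma$ sends the node labeled $ys_1\dots s_m$ to the node labeled $\sigma(y)t_1\dots t_m$, and $\operatorname{sgn}_m(\sigma,y)\in\{\pm1\}$ is the sign of the permutation $(s_1,\dots,s_m)\mapsto(t_1,\dots,t_m)$ of $\{0,1\}^m$. $\widetilde{M}_\ell$ is the set of $\sigma\in\operatorname{Aut}(T_\infty)$ with $\operatorname{sgn}_\ell(\sigma,y)=\operatorname{sgn}_\ell(\sigma,x_0)$ for every node $y$; $M_\ell$ is the set of $\sigma\in\widetilde{M}_\ell$ for which $\operatorname{sgn}_\ell(\sigma,x_0)=+1$. *)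

(* Defs.v *)
From HB Require Import structures.
From mathcomp Require Import all_boot all_order all_algebra all_fingroup.
From mathcomp Require Import boolp classical_sets.

Set Implicit Arguments.
Unset Strict Implicit.
Unset Printing Implicit Defensive.

Inductive at_level_of (V : Type) (root : V) (child : V -> V -> Prop) :
    nat -> V -> Prop :=
| At_level_root : at_level_of root child 0 root
| At_level_child m x y :
    at_level_of root child m x -> child x y -> at_level_of root child m.+1 y.

(* [child x y] reads "y is a child of x". The axioms determine the tree up to *)
(* isomorphism.                                                               *)
Record binary_tree := BinaryTree {
  node :> Type;
  root : node;
  child : node -> node -> Prop;
  root_not_child : forall x, ~ child x root;
  parent_uniq : forall x x' y, child x y -> child x' y -> x = x';
  two_children : forall x, exists a b,
    a <> b /\ (forall y, child x y <-> y = a \/ y = b);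
  root_reaches : forall x, exists m, at_level_of root child m x }.

Arguments root {b}.
Arguments child {b}.

Definition at_level (T : binary_tree) : nat -> T -> Prop :=
  at_level_of root child.

Record labeling (T : binary_tree) := Labeling {
  label :> T -> seq bool;
  label_root : label root = [::];
  label_size : forall m x, at_level m x -> size (label x) = m;
  label_bij : forall m w, size w = m ->
    exists! x, at_level m x /\ label x = w;
  label_child : forall x y, child x y -> exists b, label y = rcons (label x) b;
  child_label : forall x b, exists y, child x y /\ label y = rcons (label x) b }.

Record tree_aut (T : binary_tree) := TreeAut {
  aut_fun :> T -> T;
  aut_bij : bijective aut_fun;
  aut_root : aut_fun root = root;
  aut_child : forall x y, child (aut_fun x) (aut_fun y) <-> child x y }.

Section Aut.
Variable T : binary_tree.
Implicit Types s t : tree_aut T.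

Lemma tree_aut_ext s t : s =1 t -> s = t.
Proof.
case: s t => [f fb fr fc] [g gb gr gc] /= fg.
have {}fg : f = g by apply/funext.
subst g; congr TreeAut; exact: Prop_irrelevance.
Qed.

Definition tree_aut1 : tree_aut T.
Proof. by exists (fun x : T => x) => //; exists (fun x : T => x). Defined.

Definition tree_autM s t : tree_aut T.
Proof.
exists (fun x => s (t x)).
- exact: bij_comp (aut_bij s) (aut_bij t).
- by rewrite !aut_root.
- by move=> x y; rewrite !aut_child.
Defined.

Lemma tree_aut_inv_ex s : exists g : T -> T, cancel s g /\ cancel g s.
Proof. by case: (aut_bij s) => g; exists g. Qed.

Definition tree_autV s : tree_aut T.
Proof.
exists (sval (cid (tree_aut_inv_ex s))); case: cid => /= g [sK gK].
- by exists s.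
- by rewrite -{1}(aut_root s) sK.
- by move=> x y; rewrite -(aut_child s) !gK.
Defined.

Lemma tree_autMA : associative tree_autM.
Proof. by move=> s t u; apply: tree_aut_ext. Qed.

Lemma tree_aut1M : left_id tree_aut1 tree_autM.
Proof. by move=> s; apply: tree_aut_ext. Qed.

Lemma tree_autM1 : right_id tree_aut1 tree_autM.
Proof. by move=> s; apply: tree_aut_ext. Qed.

Lemma tree_autVM : left_inverse tree_aut1 tree_autV tree_autM.
Proof. by move=> s; apply: tree_aut_ext => x /=; case: cid => g /= []. Qed.

Lemma tree_autMV : right_inverse tree_aut1 tree_autV tree_autM.
Proof. by move=> s; apply: tree_aut_ext => x /=; case: cid => g /= []. Qed.

HB.instance Definition _ := gen_eqMixin (tree_aut T).
HB.instance Definition _ := gen_choiceMixin (tree_aut T).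
HB.instance Definition _ := isGroup.Build (tree_aut T)
  tree_autMA tree_aut1M tree_autM1 tree_autVM tree_autMV.

End Aut.

Section Sign.
Variables (T : binary_tree) (L : labeling T).
Implicit Types (x y : T) (w : seq bool) (s : tree_aut T).

Lemma node_at_ex w : exists x, L x = w.
Proof. by have [x [[_ xw] _]] := label_bij L (erefl (size w)); exists x. Qed.

Definition node_at w : T := sval (cid (node_at_ex w)).

Lemma node_atK : cancel node_at L.
Proof. by move=> w; rewrite /node_at; case: cid. Qed.

Lemma label_inj : injective L.
Proof.
move=> x y xy; have [z [_ zP]] := label_bij L (erefl (size (L x))).
have lev u : L u = L x -> at_level (size (L x)) u.
  move=> ux; have [m um] := root_reaches u.
  by rewrite -ux (label_size L um).
have <- : z = x by apply: zP; split=> //; exact: lev.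
by apply: zP; split=> //; apply: lev.
Qed.

Lemma labelK : cancel L node_at.
Proof. by move=> x; apply: label_inj; rewrite node_atK. Qed.

Lemma child_node_at w b : child (node_at w) (node_at (rcons w b)).
Proof.
have [y [xy yE]] := child_label L (node_at w) b.
by rewrite node_atK in yE; rewrite -yE labelK.
Qed.

Lemma aut_label_cat s y w : exists2 t, size t = size w &
  L (s (node_at (L y ++ w))) = L (s y) ++ t.
Proof.
elim/last_ind: w => [|w b [t tw IH]]; first by exists [::]; rewrite // !cats0 labelK.
have /(aut_child s) := child_node_at (L y ++ w) b.
move=> /(label_child L)[c]; rewrite IH !rcons_cat => E.
by exists (rcons t c); rewrite // !size_rcons tw.
Qed.

(* The map (s_1, ..., s_m) |-> (t_1, ..., t_m) of the definition of sgn_m: it *)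
(* is characterized by [section_funE].                                        *)
Definition section_word s y w : seq bool :=
  drop (size (L (s y))) (L (s (node_at (L y ++ w)))).

Lemma size_section_word m s y (w : m.-tuple bool) :
  size (section_word s y w) == m.
Proof.
have [t tw tE] := aut_label_cat s y w.
by rewrite /section_word tE drop_size_cat // tw size_tuple.
Qed.

Definition section_fun m s y (w : m.-tuple bool) : m.-tuple bool :=
  Tuple (size_section_word s y w).

Lemma section_funE m s y (w : m.-tuple bool) :
  L (s (node_at (L y ++ w))) = L (s y) ++ section_fun s y w.
Proof.
have [t tw tE] := aut_label_cat s y w.
by rewrite /= /section_word tE drop_size_cat.
Qed.

Lemma section_fun_inj m s y : injective (@section_fun m s y).
Proof.
move=> w w' ww'; have := section_funE s y w; rewrite ww' -section_funE.
move=> /label_inj /(bij_inj (aut_bij s)) /(can_inj node_atK) /eqP.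
by rewrite eqseq_cat // eqxx => /eqP/val_inj.
Qed.

Definition section_perm m s y : {perm m.-tuple bool} :=
  perm (@section_fun_inj m s y).

Definition sgn m s y : int := ((-1) ^+ odd_perm (section_perm m s y))%R.

Definition Mtilde l : set (tree_aut T) := [set s | forall y, sgn l s y = sgn l s root].

Definition M l : set (tree_aut T) := [set s | Mtilde l s /\ sgn l s root = 1%R].

End Sign.

(* Main.v *)
Require Import Defs.
From mathcomp Require Import all_boot all_order all_algebra all_fingroup.
From mathcomp Require Import boolp classical_sets.

Import GRing.Theory.

(** The section permutations form a cocycle, so that
    sgn(s t, y) = sgn(s, t y) sgn(t, y) and sgn(s^-1, y) = sgn(s, s^-1 y).
    Hence if sgn(s, -) and sgn(t, -) are constant, then so is sgn(s t^-1, -),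
    with value the product of the two constants. *)

Section SignCocycle.
Variables (T : binary_tree) (L : labeling T) (m : nat).
Implicit Types (s t : tree_aut T) (y : T).

Lemma section_perm1 y : section_perm L m (1%g : tree_aut T) y = 1%g.
Proof.
apply/permP => w; rewrite permE perm1; apply/val_inj.
by rewrite /= /section_word /= node_atK drop_size_cat.
Qed.

(* Permutations compose from left to right, tree automorphisms from right to
   left. *)
Lemma section_permM s t y :
  section_perm L m (s * t)%g y
  = (section_perm L m t y * section_perm L m s (t y))%g.
Proof.
apply/permP => w; rewrite permM !permE; apply/val_inj.
(* [L (t y)] followed by the word produced by [t] is the label of the image node, so [s] acts on
   that very node. *)
by rewrite /= {2}/section_word -section_funE labelK.
Qed.

Lemma sgn1 y : sgn L m (1%g : tree_aut T) y = 1%R.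
Proof. by rewrite /sgn section_perm1 odd_perm1 expr0. Qed.

Lemma sgnM s t y : sgn L m (s * t)%g y = (sgn L m s (t y) * sgn L m t y)%R.
Proof. by rewrite /sgn section_permM odd_permM signr_addb mulrC. Qed.

Lemma sgn_sqr s y : (sgn L m s y * sgn L m s y = 1)%R.
Proof. by rewrite /sgn -signr_addb addbb expr0. Qed.

Lemma sgnV s y : sgn L m s^-1%g y = sgn L m s (s^-1%g y).
Proof.
have := sgnM s s^-1%g y; rewrite mulgV sgn1 => e.
(* A sign is its own inverse, so multiplying [e] by the sign of [s] isolates that of [s^-1]. *)
by rewrite -[LHS]mul1r -(sgn_sqr s (s^-1%g y)) -mulrA -e mulr1.
Qed.

(** Inversion only moves the node at which the sign of [s] is read, which constancy makes
    irrelevant. *)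
Lemma Mtilde_sgnV s : Mtilde L m s ->
  forall y, sgn L m s^-1%g y = sgn L m s Defs.root.
Proof. by move=> sM y; rewrite sgnV sM. Qed.

Lemma Mtilde_sgn_div s t : Mtilde L m s -> Mtilde L m t ->
  forall y, sgn L m (s * t^-1)%g y = (sgn L m s Defs.root * sgn L m t Defs.root)%R.
Proof. by move=> sM tM y; rewrite sgnM sM Mtilde_sgnV. Qed.

Lemma Mtilde1 : Mtilde L m 1%g.
Proof. by move=> y; rewrite !sgn1. Qed.

Lemma Mtilde_div s t :
  Mtilde L m s -> Mtilde L m t -> Mtilde L m (s * t^-1)%g.
Proof. by move=> sM tM y; rewrite !Mtilde_sgn_div. Qed.

End SignCocycle.

Theorem theorem2p3 (T : binary_tree) (L : labeling T) (l : nat) (hl : 2 <= l) :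
  group_closed [in Mtilde L l] /\ group_closed [in M L l].
Proof.
split; split.
- by apply/mem_set; apply: Mtilde1.
- by move=> s t /set_mem sM /set_mem tM; apply/mem_set; apply: Mtilde_div.
- by apply/mem_set; split; [apply: Mtilde1 | apply: sgn1].
- move=> s t /set_mem[sM s1] /set_mem[tM t1]; apply/mem_set; split.
    exact: Mtilde_div.
  (* Both constants are 1, hence so is their product. *)
  by rewrite Mtilde_sgn_div // s1 t1 mulr1.
Qed.
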